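(* Let $A\in\mathbb{R}^{n\times n}$, $B\in\mathbb{R}^{n\times m}$, $Q\in\mathbb{R}^{n\times n}$ with $Q\succeq\mathbf{0}$, and $R\in\mathbb{R}^{m\times m}$ with $R\succ\mathbf{0}$. Assume that there exist matrices $X,W\in\mathbb{R}^{n\times n}$ with $X\succ\mathbf{0}$, $W\succ\mathbf{0}$, and matrices $Y,\underline{P}\in\mathbb{R}^{n\times n}$ (not necessarily symmetric) such that $$XA^T+AX-Y^TBR^{-1}B^T-BR^{-1}B^TY\prec\mathbf{0}$$ and $$\begin{bmatrix} A^T\underline{P}+\underline{P}^TA-Q+W & (I+Y^TA)^T & \underline{P}^TB\\ I+Y^TA & X & \mathbf{0}_{n\times m}\\ (\underline{P}^TB)^T & \mathbf{0}_{m\times n} & R\end{bmatrix}\succ\mathbf{0},$$ where $I=I_{n\times n}$. Put $P=YX^{-1}$. Then: (i) the matrix $A-BR^{-1}B^TP$ is Hurwitz; (ii) if, in addition, $A-BR^{-1}B^TP$ is symmetric and there exists $\hat{P}\in\mathbb{R}^{n\times n}$ (not necessarily symmetric) such that $$(A-BR^{-1}B^TP)\hat{P}+\hat{P}^T(A-BR^{-1}B^TP)+W=\mathbf{0},$$ then for every nonzero $\mathbf{x}_0\in\mathbb{R}^n$ the following holds. Let $\mathbf{x}(t)$, $t\ge t_0$, be the solution of $\dot{\mathbf{x}}(t)=A\mathbf{x}(t)+B\mathbf{u}(t)$, $\mathbf{x}(t_0)=\mathbf{x}_0$, under the feedback control law $\mathbf{u}(t)=-R^{-1}B^TP\,\mathbf{x}(t)$,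 and let $$\bar{\gamma}(\mathbf{x}_0)=\operatorname{trace}(P-\underline{P}+\hat{P})\,\mathbf{x}_0^T\mathbf{x}_0 .$$ Then $\mathbf{x}(t)\to\mathbf{0}$ as $t\to\infty$, $\bar{\gamma}(\mathbf{x}_0)>0$, and the cost $$J=\int_{t_0}^{\infty}\left(\mathbf{x}^T(t)Q\mathbf{x}(t)+\mathbf{u}^T(t)R\mathbf{u}(t)\right)dt$$ satisfies $J<\bar{\gamma}(\mathbf{x}_0)$.
   Context: For a real square matrix $M$, $M\succ\mathbf{0}$ (respectively $M\succeq\mathbf{0}$, $M\prec\mathbf{0}$) means that $M$ is symmetric and positive-definite (respectively symmetric positive-semidefinite, symmetric negative-definite). A real square matrix is Hurwitz if all its eigenvalues have strictly negative real parts. All matrices are constant in time. *)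

(* Defs.v *)
From HB Require Import structures.
From mathcomp Require Import all_boot all_order all_algebra.
From mathcomp Require Import all_classical all_reals all_analysis.
From mathcomp Require Import complex.

Set Implicit Arguments.
Unset Strict Implicit.
Unset Printing Implicit Defensive.

Import Order.TTheory GRing.Theory Num.Theory.
Import numFieldNormedType.Exports.

Local Open Scope classical_set_scope.
Local Open Scope ring_scope.

(* The real scalars are named [F]: [R] is the control weight matrix. *)

Definition qform (F : realType) (n : nat) (M : 'M[F]_n) (v : 'cV[F]_n) : F :=
  (v^T *m M *m v) 0 0.

Definition posdefmx (F : realType) (n : nat) (M : 'M[F]_n) : Prop :=
  M^T = M /\ forall v : 'cV[F]_n, v != 0 -> 0 < qform M v.

Definition possemidefmx (F : realType) (n : nat) (M : 'M[F]_n) : Prop :=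
  M^T = M /\ forall v : 'cV[F]_n, 0 <= qform M v.

Definition negdefmx (F : realType) (n : nat) (M : 'M[F]_n) : Prop :=
  M^T = M /\ forall v : 'cV[F]_n, v != 0 -> qform M v < 0.

(* [eigenvalue] uses row (left) eigenvectors; a square matrix has the same left
   and right eigenvalues. *)
Definition hurwitz (F : realType) (n : nat) (M : 'M[F]_n) : Prop :=
  forall z : F[i],
    eigenvalue (map_mx (real_complex F) M) z -> complex.Re z < 0.

(* Only the values of [x] and [u] on [t0, +oo[ matter. Continuity on [t0, +oo[
   makes the initial condition effective. *)
Definition lti_solution (F : realType) (n m : nat)
    (A : 'M[F]_n) (B : 'M[F]_(n, m)) (u : F -> 'cV[F]_m)
    (t0 : F) (x0 : 'cV[F]_n) (x : F -> 'cV[F]_n) : Prop :=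
  [/\ x t0 = x0,
      {within `[t0, +oo[, continuous x}
    & forall t : F, t0 < t -> is_derive t 1 x (A *m x t + B *m u t)].

Definition quadratic_cost (F : realType) (n m : nat)
    (Q : 'M[F]_n) (R : 'M[F]_m) (t0 : F)
    (x : F -> 'cV[F]_n) (u : F -> 'cV[F]_m) : \bar F :=
  (\int[lebesgue_measure]_(t in `[t0, +oo[)
     (qform Q (x t) + qform R (u t))%:E)%E.

Definition block3_mx (F : realType) (n m : nat)
    (M11 M12 : 'M[F]_n) (M13 : 'M[F]_(n, m))
    (M21 M22 : 'M[F]_n) (M23 : 'M[F]_(n, m))
    (M31 M32 : 'M[F]_(m, n)) (M33 : 'M[F]_m) : 'M[F]_(n + n + m) :=
  block_mx (block_mx M11 M12 M21 M22) (col_mx M13 M23)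
           (row_mx M31 M32)           M33.

(* Main.v *)
Require Import Defs.
From HB Require Import structures.
From mathcomp Require Import all_boot all_order all_algebra.
From mathcomp Require Import all_classical all_reals all_analysis.
From mathcomp Require Import measurable_realfun complex ring lra.

Set Implicit Arguments.
Unset Strict Implicit.
Unset Printing Implicit Defensive.

Import Order.TTheory GRing.Theory Num.Theory.
Import numFieldNormedType.Exports.

Local Open Scope classical_set_scope.
Local Open Scope ring_scope.

(** Write [S = B R^-1 B^T] and let [K = A - S P] be the closed-loop matrix.

    The first inequality is the Lyapunov inequality [K X + X K^T < 0] in
    disguise, because [P X = Y]; with [X > 0] it makes [K] Hurwitz
    ([lyapunov_hurwitz]).  If [K] is moreover symmetric, then [L = - K] is
    positive-definite ([hurwitz_symmetric_posdef]), and the closed loop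
    [x' = - L x] is a gradient flow, for which
    [d/dt |x|^2 = - 2 x^T L x].  Hence [x] tends to [0] and
    [\int x^T L x = |x0|^2 / 2].

    Under the feedback the running cost is [x^T M x] with
    [M = Q + P^T S P].  Testing the block inequality on the vectors
    [(v, - X^-1 v, u)], where [u] is the control associated with the state
    [v], shows that [M < N], where
    [N = K^T D + D^T K + W] and [D = Pl - P] ([lmi_certificate]).
    The equation satisfied by [Phat] rewrites [N] as [L G + G^T L] with
    [G = P - Pl + Phat], so [tr (L^-1 N) = 2 tr G] ([trace_lyapunov]).

    It remains to compare [N] with [L].  For positive-definite matrices,
    [x^T N x <= tr (L^-1 N) x^T L x] ([qform_le_trace]): write [N] as a sum
    of rank-one matrices [w w^T] and apply Cauchy-Schwarz for the scalar
    product defined by [L] to each of them.  Integrating along the flow, the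
    cost is at most [tr (L^-1 N) / 2 * |x0|^2 = tr G * |x0|^2].  The
    inequality is strict because [N - M] is positive-definite, hence dominates
    [e L] for some [e > 0], again by [qform_le_trace]. *)

(** * Quadratic forms *)

Lemma qformD (F : realType) n (M N : 'M[F]_n) v :
  qform (M + N) v = qform M v + qform N v.
Proof. by rewrite /qform mulmxDr mulmxDl mxE. Qed.

Lemma qformN (F : realType) n (M : 'M[F]_n) v : qform (- M) v = - qform M v.
Proof. by rewrite /qform mulmxN mulNmx mxE. Qed.

Lemma qformZ (F : realType) n a (M : 'M[F]_n) v :
  qform (a *: M) v = a * qform M v.
Proof. by rewrite /qform -scalemxAr -scalemxAl mxE. Qed.

Lemma qform_tr (F : realType) n (M : 'M[F]_n) v : qform M^T v = qform M v.
Proof.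
have tE : v^T *m M^T *m v = (v^T *m M *m v)^T by rewrite !trmx_mul trmxK mulmxA.
by rewrite /qform tE mxE.
Qed.

Lemma qform_oppv (F : realType) n (M : 'M[F]_n) v : qform M (- v) = qform M v.
Proof. by rewrite /qform [(- v)^T]linearN /= !mulNmx mulmxN opprK. Qed.

Lemma qform_congr (F : realType) m n (T : 'M[F]_(m, n)) (M : 'M[F]_m) v :
  qform (T^T *m M *m T) v = qform M (T *m v).
Proof. by rewrite /qform trmx_mul !mulmxA. Qed.

Lemma qform_gram (F : realType) m n (V : 'M[F]_(m, n)) v :
  qform (V^T *m V) v = \sum_k (V *m v) k 0 ^+ 2.
Proof.
rewrite /qform -!mulmxA mulmxA -trmx_mul mxE.
by apply: eq_bigr => k _; rewrite mxE expr2.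
Qed.

Lemma qform1 (F : realType) n (v : 'cV[F]_n) :
  qform 1%:M v = \sum_i v i 0 ^+ 2.
Proof.
have -> : (1%:M : 'M[F]_n) = 1%:M^T *m 1%:M by rewrite mulmx1 trmx1.
by rewrite qform_gram mul1mx.
Qed.

Lemma posdefmx_unit (F : realType) n (L : 'M[F]_n) :
  posdefmx L -> L \in unitmx.
Proof.
move=> [_ L0]; rewrite -row_free_unit -kermx_eq0; apply/negPn/negP.
move=> /rowV0Pn[v /sub_kermxP vL v0].
by have := L0 v^T; rewrite trmx_eq0 v0 /qform trmxK vL mul0mx mxE ltxx => /(_ isT).
Qed.

Lemma posdefmx_inv (F : realType) n (L : 'M[F]_n) :
  posdefmx L -> posdefmx (invmx L).
Proof.
move=> pL; have uL := posdefmx_unit pL; case: pL => sL L0.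
have sI : (invmx L)^T = invmx L by rewrite trmx_inv sL.
split=> // v v0.
have -> : invmx L = (invmx L)^T *m L *m invmx L by rewrite sI mulVmx// mul1mx.
rewrite qform_congr; apply: L0; apply: contra_neq v0 => e.
by rewrite -(mulKVmx uL v) e mulmx0.
Qed.

Lemma posdefmx1 (F : realType) n : posdefmx (1%:M : 'M[F]_n).
Proof.
split=> [|v v0]; first exact: trmx1.
rewrite qform1 lt_neqAle sumr_ge0 ?andbT; last by move=> *; exact: sqr_ge0.
apply: contra_neq v0 => /esym/eqP; rewrite psumr_eq0; last by move=> *; exact: sqr_ge0.
move=> /allP h; apply/colP => i; rewrite mxE.
by have := h i (mem_index_enum _); rewrite /= sqrf_eq0 => /eqP.
Qed.

Lemma posdefmx_semidef (F : realType) n (L : 'M[F]_n) :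
  posdefmx L -> possemidefmx L.
Proof.
move=> [sL L0]; split=> // v; have [->|/L0/ltW//] := eqVneq v 0.
by rewrite /qform mulmx0 mxE.
Qed.

Lemma qform_subZ (F : realType) n (L : 'M[F]_n) x w k : L^T = L ->
  qform L (x - k *: w)
  = qform L x - 2 * k * (w^T *m L *m x) 0 0 + k ^+ 2 * qform L w.
Proof.
move=> sL.
have wx : (x^T *m L *m w) 0 0 = (w^T *m L *m x) 0 0.
  by rewrite -[x^T *m L *m w]trmxK mxE !trmx_mul trmxK sL mulmxA.
have tE : (x - k *: w)^T = x^T - k *: w^T by rewrite linearB /= linearZ.
rewrite /qform tE !mulmxBl !mulmxBr -!scalemxAl -!scalemxAr.
move: wx; move: (x^T *m L *m w) (w^T *m L *m x) (w^T *m L *m w) (x^T *m L *m x).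
by move=> p q r s pq; rewrite !mxE pq; ring.
Qed.

(** The quadratic form is nonnegative at the residue of the [L]-orthogonal
    projection of [x] on [w]. *)
Lemma cauchy_schwarz_posdef (F : realType) n (L : 'M[F]_n) w x :
  posdefmx L -> (w^T *m L *m x) 0 0 ^+ 2 <= qform L w * qform L x.
Proof.
move=> pL; have [sL L0] := pL; have [_ L0'] := posdefmx_semidef pL.
have [->|w0] := eqVneq w 0; first by rewrite /qform trmx0 !mul0mx !mxE expr0n mul0r.
have c0 := L0 _ w0; set b := (w^T *m L *m x) 0 0.
have := L0' (x - (b / qform L w) *: w); rewrite qform_subZ// -/b.
move: (qform L w) (qform L x) c0 => c d c0.
have -> : d - 2 * (b / c) * b + (b / c) ^+ 2 * c = (c * d - b ^+ 2) / c.
  by field; rewrite gt_eqF.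
by rewrite pmulr_lge0 ?invr_gt0// subr_ge0.
Qed.

(** Writes a positive-definite matrix as a sum of rank-one matrices, one for
    each row of [V].  The induction eliminates the first coordinate: the Schur
    complement of the top left entry is positive-definite, because its value
    at [v] is the minimum of the form over the vectors with tail [v]. *)
Lemma cholesky (F : realType) n (M : 'M[F]_n) :
  posdefmx M -> exists V : 'M[F]_n, M = V^T *m V.
Proof.
elim: n M => [M _|n IH]; first by exists 0; rewrite [M]flatmx0 [RHS]flatmx0.
rewrite -[n.+1]/(1 + n)%N => M [sM M0].
pose a := M 0 0; pose r := ursubmx M; pose D := drsubmx M.
have ME : M = block_mx a%:M r r^T D.
  rewrite -[LHS]submxK; congr block_mx.
    by rewrite [LHS]mx11_scalar !mxE; congr ((M _ _)%:M); exact/val_inj.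
  by rewrite /r trmx_ursub sM.
have a0 : 0 < a.
  have := M0 (col_mx 1 0); rewrite ME /qform tr_col_mx mul_row_block mul_row_col.
  rewrite !trmx0 trmx1 !mul1mx !mul0mx !mulmx0 !mulmx1 !addr0 mxE eqxx; apply.
  by rewrite col_mx_eq0 oner_eq0.
have [|V' V'E] := IH (D - a^-1 *: (r^T *m r)).
  have sD : D^T = D by rewrite /D trmx_drsub sM.
  split; first by rewrite linearB /= linearZ /= trmx_mul trmxK sD.
  (* [y] is the first coordinate that minimises the form when the tail is [v]. *)
  move=> v v0; pose y := - a^-1 *: (r *m v).
  have := M0 (col_mx y v); rewrite col_mx_eq0 (negPf v0) andbF => /(_ isT).
  suff -> : qform M (col_mx y v) = qform (D - a^-1 *: (r^T *m r)) v by [].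
  set s := r *m v in y *; have sE : v^T *m r^T = s^T by rewrite trmx_mul.
  have yE : y^T = - a^-1 *: s^T by rewrite linearZ.
  have -> : qform (D - a^-1 *: (r^T *m r)) v = qform D v - a^-1 * (s^T *m s) 0 0.
    by rewrite qformD qformN qformZ /qform !mulmxA sE -(mulmxA s^T).
  rewrite ME /qform tr_col_mx mul_row_block mul_row_col yE sE /y !mulmxDl.
  rewrite -?scalemxAl -?scalemxAr -?scalemxAl mul_mx_scalar -!mulmxA -/s.
  rewrite -?scalemxAl; move: (s^T *m s) (v^T *m (D *m v)) => p q.
  by rewrite !mxE; field; rewrite gt_eqF.
pose b := Num.sqrt a; have b0 : 0 < b by rewrite sqrtr_gt0.
have bb : b * b = a by rewrite -expr2 sqr_sqrtr// ltW.
exists (block_mx b%:M (b^-1 *: r) 0 V').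
rewrite tr_block_mx mulmx_block !trmx0 !mul0mx !mulmx0 !addr0 -V'E.
rewrite tr_scalar_mx -scalar_mxM bb [_^T]linearZ /= ME; congr block_mx.
- by rewrite mul_scalar_mx scalerA divff ?scale1r// gt_eqF.
- by rewrite mul_mx_scalar scalerA divff ?scale1r// gt_eqF.
- by rewrite -scalemxAl -scalemxAr scalerA -invfM bb addrC subrK.
Qed.

(** With [N = V^T V], the form is the sum of the squares of [(row k V) x],
    which is the [L]-scalar product of [x] and [L^-1 (row k V)^T].
    Cauchy-Schwarz bounds each square by
    [(row k V) L^-1 (row k V)^T * (x^T L x)], and the first factors add up to
    the trace.  This single estimate replaces every comparison of
    eigenvalues. *)
Lemma qform_le_trace (F : realType) n (L N : 'M[F]_n) x :
  posdefmx L -> posdefmx N ->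
  qform N x <= \tr (invmx L *m N) * qform L x.
Proof.
move=> pL /cholesky[V ->]; have [sI _] := posdefmx_inv pL.
have uL := posdefmx_unit pL.
rewrite qform_gram mulmxA mxtrace_mulC mulmxA /mxtrace mulr_suml.
apply: ler_sum => k _.
have := cauchy_schwarz_posdef (invmx L *m (row k V)^T) x pL.
rewrite -qform_congr sI mulVmx// mul1mx trmx_mul trmxK sI -!mulmxA mulKmx//.
have -> : qform (invmx L) (row k V)^T = (V *m (invmx L *m V^T)) k k.
  rewrite /qform trmxK tr_row -row_mul mulmxA [LHS]mxE [RHS]mxE.
  by apply: eq_bigr => j _; rewrite [row _ _ _ _]mxE [col _ _ _ _]mxE.
by rewrite -row_mul mxE.
Qed.

(** * Lyapunov inequalities and symmetric Hurwitz matrices *)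

(** For a left eigenvector [a^T + i b^T] of [K], the values at [a] and [b] of
    the form of [K X + X K^T] add up to [2 Re z (a^T X a + b^T X b)]; the terms
    with [Im z] cancel because [X] is symmetric.  Splitting into real and
    imaginary parts keeps all the quadratic forms real. *)
Lemma lyapunov_hurwitz (F : realType) n (K X : 'M[F]_n) :
  posdefmx X -> negdefmx (K *m X + X *m K^T) -> hurwitz K.
Proof.
move=> [sX X0] [_ KX0] z /eigenvalueP[v vK v0].
pose a : 'cV[F]_n := \col_j complex.Re (v 0 j).
pose b : 'cV[F]_n := \col_j complex.Im (v 0 j).
have vKj j : \sum_k v 0 k * (K k j)%:C%C = z * v 0 j.
  have /rowP/(_ j) := vK; rewrite !mxE => <-.
  by apply: eq_bigr => k _; rewrite mxE.
have aK : K^T *m a = complex.Re z *: a - complex.Im z *: b.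
  apply/colP => j; move: (congr1 (@complex.Re F) (vKj j)).
  rewrite (big_morph (@complex.Re F) (id1 := 0) (op1 := +%R)) => [|[x y] [x' y']//|//].
  rewrite !mxE; case: (z) (v 0 j) => zr zi [vr vi] /= <-.
  by apply: eq_bigr => k _; rewrite !mxE; case: (v 0 k) => x y /=; ring.
have bK : K^T *m b = complex.Re z *: b + complex.Im z *: a.
  apply/colP => j; move: (congr1 (@complex.Im F) (vKj j)).
  rewrite (big_morph (@complex.Im F) (id1 := 0) (op1 := +%R)) => [|[x y] [x' y']//|//].
  rewrite !mxE; case: (z) (v 0 j) => zr zi [vr vi] /= <-.
  by apply: eq_bigr => k _; rewrite !mxE; case: (v 0 k) => x y /=; ring.
have qK w : qform (K *m X + X *m K^T) w = 2 * ((K^T *m w)^T *m X *m w) 0 0.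
  rewrite qformD -[qform (X *m _) w]qform_tr trmx_mul trmxK sX mulrDl mul1r.
  by rewrite /qform trmx_mul trmxK !mulmxA.
have sab : (b^T *m X *m a) 0 0 = (a^T *m X *m b) 0 0.
  by rewrite -[b^T *m X *m a]trmxK mxE !trmx_mul trmxK sX mulmxA.
have key : qform (K *m X + X *m K^T) a + qform (K *m X + X *m K^T) b
  = 2 * complex.Re z * (qform X a + qform X b).
  rewrite !qK aK bK.
  have -> : (complex.Re z *: a - complex.Im z *: b)^T
    = complex.Re z *: a^T - complex.Im z *: b^T by rewrite linearB /= !linearZ.
  have -> : (complex.Re z *: b + complex.Im z *: a)^T
    = complex.Re z *: b^T + complex.Im z *: a^T by rewrite linearD /= !linearZ.
  rewrite /qform !mulmxBl !mulmxDl -!scalemxAl; move: sab.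
  move: (b^T *m X *m a) (a^T *m X *m b) (a^T *m X *m a) (b^T *m X *m b).
  by move=> p q r s pq; rewrite !mxE pq; ring.
have X0' w : 0 <= qform X w by have [_] := posdefmx_semidef (conj sX X0); apply.
have KX0' w : qform (K *m X + X *m K^T) w <= 0.
  by have [->|/KX0/ltW//] := eqVneq w 0; rewrite /qform mulmx0 mxE.
have ab : (a != 0) || (b != 0).
  rewrite -negb_and; apply: contra_neqN v0 => /andP[/eqP/colP a0 /eqP/colP b0].
  apply/rowP => j; apply/eqP; rewrite mxE eq_complex /=.
  by have := a0 j; have := b0 j; rewrite !mxE => -> ->; rewrite eqxx.
have lt0 : qform (K *m X + X *m K^T) a + qform (K *m X + X *m K^T) b < 0.
  by case/orP: ab => /KX0; [have := KX0' b|have := KX0' a]; lra.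
have gt0 : 0 < qform X a + qform X b.
  by case/orP: ab => /X0; [have := X0' b|have := X0' a]; lra.
by move: lt0; rewrite key pmulr_llt0// pmulr_rlt0.
Qed.

(** [G] need not be symmetric: the two summands have the same trace after
    multiplication by [L^-1], by cyclicity and invariance under
    transposition. *)
Lemma trace_lyapunov (F : realType) n (L G N : 'M[F]_n) :
  L \in unitmx -> L *m G + G^T *m L = N -> \tr (invmx L *m N) = 2 * \tr G.
Proof.
move=> uL <-; rewrite mulmxDr mulKmx// mxtraceD mulmxA mxtrace_mulC mulmxA.
by rewrite mulmxV// mul1mx mxtrace_tr mulrDl mul1r.
Qed.

Lemma eigenvalue_spectral_diag (C : numClosedFieldType) n (M : 'M[C]_n) i :
  M \is normalmx -> eigenvalue M (spectral_diag M 0 i).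
Proof.
move=> /orthomx_spectralP ME; set P := spectralmx M in ME *.
have uP : P \in unitmx by exact: spectral_unit.
apply/eigenvalueP; exists (row i P).
  rewrite [X in _ *m X]ME -row_mul -[invmx P *m _ *m P]mulmxA mulKVmx//.
  by rewrite row_mul row_diag_mx -scalemxAl -rowE.
apply/eqP => Pi0; have := congr1 (fun u => (u *m invmx P) 0 i) Pi0.
by rewrite -row_mul mulmxV// mul0mx !mxE eqxx => /eqP; rewrite oner_eq0.
Qed.

(** Spectral theorem for [K] seen as a hermitian matrix: in a unitary
    eigenbasis the form is a combination of squared moduli whose coefficients
    are the eigenvalues of [K], which are real, hence negative. *)
Lemma hurwitz_symmetric_posdef (F : realType) n (K : 'M[F]_n) :
  K^T = K -> hurwitz K -> posdefmx (- K).
Proof.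
move=> sK hK; split=> [|v v0]; first by rewrite linearN /= sK.
rewrite qformN oppr_gt0.
pose M := map_mx (real_complex F) K.
have hM : M \is hermsymmx.
  apply: realsym_hermsym.
    by apply/is_hermitianmxP; rewrite expr0 scale1r map_mx_id// /M map_trmx sK.
  by apply/mxOverP => i j; rewrite mxE complex_real.
have nM := hermitian_normalmx hM.
have := orthomx_spectralP nM; rewrite invmx_unitary ?spectral_unitarymx//.
set P := spectralmx M; set d := spectral_diag M => ME.
have uP : P \in unitmx by exact: spectral_unit.
have d0 i : d 0 i < 0.
  have : d 0 i \is Num.real by have /mxOverP := hermitian_spectral_diag_real hM; apply.
  have := hK _ (eigenvalue_spectral_diag i nM); rewrite -/d.
  by case: (d 0 i) => x y /= x0; rewrite complex_real => /eqP->; rewrite ltcR.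
pose V := map_mx (real_complex F) v; pose w := P *m V.
have w0 : w != 0.
  apply: contra_neq v0 => w0; have : V = 0 by rewrite -(mulKmx uP V) -/w w0 mulmx0.
  by move=> /colP V0; apply/colP => i; have := V0 i; rewrite !mxE => /complexI.
have VE : V^T = map_mx Num.conj V^T.
  by apply/matrixP => i j; rewrite !mxE; apply/esym/CrealP; rewrite complex_real.
rewrite -ltcR -[X in _ < X]/(0 : F[i]).
have -> : (qform K v)%:C%C = \sum_i d 0 i * `|w i 0| ^+ 2.
  transitivity ((V^T *m M *m V) 0 0).
    by rewrite map_trmx -!map_mxM mxE.
  rewrite ME VE !mulmxA -map_mxM -trmx_mul -/w -mulmxA -/w -mulmxA mxE.
  apply: eq_bigr => i _; rewrite mul_diag_mx !mxE normCK mulrCA; congr (_ * _).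
  by rewrite mulrC.
have le0 i : d 0 i * `|w i 0| ^+ 2 <= 0.
  by rewrite nmulr_rle0 ?exprn_ge0// d0.
rewrite lt_neqAle; apply/andP; split; last exact: sumr_le0.
apply: contra_neq w0 => /eqP; rewrite -oppr_eq0 -sumrN psumr_eq0; last first.
  by move=> i _; rewrite oppr_ge0.
move=> /allP h; apply/colP => i; rewrite [RHS]mxE; have := h i (mem_index_enum _).
by rewrite /= oppr_eq0 mulf_eq0 lt_eqF//= expf_eq0 normr_eq0 => /eqP.
Qed.

(** * From the block inequality to a bound on the running cost *)

(** [U] is the feedback gain.  The block form is evaluated on the range of
    [T = (1, - X^-1, - U)], so that no Schur complement is needed.  The choice
    of [- U] turns the terms in [R] and [Pl^T B] into exactly those produced by
    the closed loop; the choice of [- X^-1] produces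
    [- (P^T A + A^T P)] from the off-diagonal block, at the price of the term
    [- X^-1], which has the favourable sign. *)
Lemma lmi_certificate (F : realType) n m (A : 'M[F]_n) (B : 'M[F]_(n, m))
    (Q X W Y Pl : 'M[F]_n) (R : 'M[F]_m)
    (P := Y *m invmx X) (U := invmx R *m B^T *m P)
    (K := A - B *m U) (D := Pl - P) :
  posdefmx X -> posdefmx R ->
  posdefmx
    (block3_mx
       (A^T *m Pl + Pl^T *m A - Q + W) (1%:M + Y^T *m A)^T (Pl^T *m B)
       (1%:M + Y^T *m A)               X                   0
       (Pl^T *m B)^T                   0                   R) ->
  posdefmx (K^T *m D + D^T *m K + W - (Q + U^T *m R *m U)).
Proof.
move=> pX pR [sM M0]; have [_ M0'] := posdefmx_semidef (conj sM M0).
have uX := posdefmx_unit pX; have uR := posdefmx_unit pR.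
have [sI I0] := posdefmx_inv pX.
have [sX _] := pX; have [sR _] := pR.
have RU : R *m U = B^T *m P by rewrite /U -mulmxA mulKVmx.
have PT : P^T = invmx X *m Y^T by rewrite trmx_mul sI.
have UTR : U^T *m R = P^T *m B by rewrite -{1}sR -trmx_mul RU trmx_mul trmxK.
(* Opaque bodies keep the rewriting rules below from expanding [P] and [U]. *)
have PE : Y *m invmx X = P by [].
clearbody U P.
set M := block3_mx _ _ _ _ _ _ _ _ _ in sM M0 M0'.
pose T := col_mx (col_mx 1%:M (- invmx X)) (- U).
suff -> : K^T *m D + D^T *m K + W - (Q + U^T *m R *m U)
    = T^T *m M *m T + invmx X.
  split; first by rewrite linearD /= sI !trmx_mul trmxK sM mulmxA.
  move=> v v0; rewrite qformD qform_congr.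
  by rewrite ltr_wpDl// I0.
rewrite /T /M /block3_mx !tr_col_mx !mul_row_block !mul_row_col.
rewrite mul_mx_row add_row_mx !mul_row_col.
have -> : (- invmx X)^T = - invmx X by rewrite linearN /= sI.
have -> : (- U)^T = - U^T by rewrite linearN.
rewrite trmx1 !mul1mx !mulmx1 !mulmx0 !mulmxN !mulNmx.
have CT : (1%:M + Y^T *m A)^T = 1%:M + A^T *m Y.
  by rewrite linearD /= trmx1 trmx_mul trmxK.
have KT : K^T = A^T - U^T *m B^T by rewrite linearB /= trmx_mul.
have DT : D^T = Pl^T - P^T by rewrite linearB.
rewrite CT KT DT /K /D mulVmx// [(Pl^T *m B)^T]trmx_mul trmxK.
rewrite !(mulmxDr, mulmxDl, mulmxBr, mulmxBl, mulmx1, mul1mx, mulNmx,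
  mulmxN, mul0mx) !mulmxA.
rewrite -PT -[A^T *m Y *m _]mulmxA PE -UTR -[U^T *m B^T *m P]mulmxA -RU !mulmxA.
apply/matrixP => i j; rewrite !mxE; ring.
Qed.

(** * Gradient flow of a positive-definite form *)

Lemma continuous_qform (F : realType) n (M : 'M[F]_n) : continuous (qform M).
Proof.
have -> : qform M = fun v => \sum_j (\sum_i v i 0 * M i j) * v j 0.
  apply/funext => v; rewrite /qform mxE; apply: eq_bigr => j _; congr (_ * _).
  by rewrite mxE; apply: eq_bigr => i _; rewrite mxE.
have cj j : continuous (fun v : 'cV[F]_n => \sum_i v i 0 * M i j).
  apply: continuous_big => [|i _ v]; first exact: add_continuous.
  apply: (@continuousM F _ (fun v : 'cV[F]_n => v i 0) (fun=> M i j)).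
    exact: coord_continuous.
  exact: cst_continuous.
apply: continuous_big => [|j _ v]; first exact: add_continuous.
apply: (@continuousM F _ (fun v : 'cV[F]_n => \sum_i v i 0 * M i j) (fun v => v j 0)).
  exact: cj.
exact: coord_continuous.
Qed.

Lemma within_continuous_qform (F : realType) n (M : 'M[F]_n) (D : set F)
    (x : F -> 'cV[F]_n) :
  {within D, continuous x} -> {within D, continuous (fun t => qform M (x t))}.
Proof.
move=> cx; apply: (@within_continuous_comp _ _ _ D x (qform M)) => // v _.
exact: continuous_qform.
Qed.

Lemma is_derive_sqnorm (F : realType) n (x : F -> 'cV[F]_n)
    (d : 'cV[F]_n) (t : F) :
  is_derive t 1 x d ->
  is_derive t 1 (fun s => qform 1%:M (x s)) (2 * ((x t)^T *m d) 0 0).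
Proof.
move=> [dx dxE].
have -> : (fun s => qform 1%:M (x s)) = \sum_i (fun s => x s i 0) ^+ 2.
  by apply/funext => s; rewrite qform1 fct_sumE.
have dxi i : is_derive t 1 (fun s => x s i 0) (d i 0).
  apply: DeriveDef; first exact: (derivable_mxP x t 1).1.
  by move: dxE; rewrite derive_mx// => /matrixP/(_ i 0); rewrite mxE.
apply: is_derive_eq.
rewrite mxE mulr_sumr; apply: eq_bigr => i _.
by rewrite mxE /= expr1 /GRing.scale /= mulrA.
Qed.

Lemma cvg_sqnorm0 (F : realType) n (x : F -> 'cV[F]_n) :
  qform 1%:M (x t) @[t --> +oo] --> (0 : F) -> x t @[t --> +oo] --> (0 : 'cV[F]_n).
Proof.
move=> V0; apply/cvgrPdist_lt => e e0.
move/cvgrPdist_lt : V0 => /(_ (e ^+ 2)); rewrite exprn_gt0// => /(_ isT).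
apply: filterS => t; rewrite !sub0r !normrN qform1 => xt.
rewrite /Num.Def.normr /= mx_normrE; apply/bigmax_ltP; split=> // -[i j] _ /=.
rewrite ord1 -(@ltr_pXn2r _ 2)// ?nnegrE ?ltW// real_normK ?num_real//.
apply: le_lt_trans xt; rewrite ger0_norm ?sumr_ge0// => [|k _]; last exact: sqr_ge0.
by rewrite (bigD1 i)//= lerDl sumr_ge0// => k _; exact: sqr_ge0.
Qed.

(** [(1 + a (t - t0)) f t] is nonincreasing.  The resulting decay in [1 / t] is
    weaker than the exponential one, but suffices. *)
Lemma differential_decay_cvg0 (F : realType) (f f' : F -> F) (t0 a : F) :
  0 < a -> {within `[t0, +oo[, continuous f} ->
  (forall t, t0 <= t -> 0 <= f t) ->
  (forall t, t0 < t -> is_derive t 1 f (f' t)) ->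
  (forall t, t0 < t -> f' t <= - a * f t) ->
  f t @[t --> +oo] --> (0 : F).
Proof.
move=> a0 cf f0 df f'le.
pose h t := (1 + a * (t - t0)) * f t.
have dh t : t0 < t -> is_derive t 1 h ((1 + a * (t - t0)) * f' t + f t * a).
  move=> /df dft; rewrite /h.
  have da : is_derive t 1 (fun t => 1 + a * (t - t0)) a.
    by apply: is_derive_eq; rewrite add0r mul1r subr0 [_ *: _]mulr1.
  exact: (is_deriveM da dft).
have ch : {within `[t0, +oo[, continuous h}.
  have cg : {within `[t0, +oo[, continuous (fun t => 1 + a * (t - t0))}.
    apply: derivable_within_continuous => t _.
    by apply: ex_derive; apply: is_derive_eq.
  by move=> t; exact: (continuousM (cg t) (cf t)).
have dh1 s : s \in `]t0, +oo[ -> derivable h s 1.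
  by rewrite in_itv/= andbT => /dh[].
have dh_le0 s : s \in `]t0, +oo[ -> derive1 h s <= 0.
  rewrite in_itv/= andbT => ts; rewrite derive1E; have [_ ->] := dh _ ts.
  have := f'le _ ts; have := f0 _ (ltW ts).
  have : 0 < s - t0 by rewrite subr_gt0.
  move: (s - t0) (f s) (f' s) => u y z u0 y0 zy.
  have : (1 + a * u) * z <= (1 + a * u) * (- a * y).
    by rewrite ler_wpM2l// addr_ge0// mulr_ge0// ltW.
  have : 0 <= a * u * (a * y) by rewrite !mulr_ge0// ltW.
  by lra.
have h_le t (tt : t0 <= t) : h t <= h t0.
  exact: (ler0_derive1_nincry dh1 dh_le0 ch (lexx t0) tt).
apply/cvgrPdist_lt => e e0.
near=> t.
have tt : t0 <= t by near: t; apply: nbhs_pinfty_ge; exact: num_real.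
rewrite sub0r normrN ger0_norm ?f0//.
have := h_le _ tt; rewrite /h subrr mulr0 addr0 mul1r => hle.
rewrite ltNge; apply/negP => et.
have : f t0 / (a * e) <= t - t0.
  rewrite lerBrDr; near: t; apply: nbhs_pinfty_ge; exact: num_real.
rewrite ler_pdivrMr ?mulr_gt0// => ft0.
have : (1 + a * (t - t0)) * e <= (1 + a * (t - t0)) * f t.
  by rewrite ler_wpM2l// addr_ge0// mulr_ge0// ?subr_ge0// ltW.
by lra.
Unshelve. all: by end_near. Qed.

Lemma is_derive_flow_sqnorm (F : realType) n (L : 'M[F]_n) (t : F)
    (x : F -> 'cV[F]_n) :
  is_derive t 1 x (- (L *m x t)) ->
  is_derive t 1 (fun s => qform 1%:M (x s)) (- (2 * qform L (x t))).
Proof.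
move=> /is_derive_sqnorm dV; apply: is_derive_eq dV _.
by rewrite mulmxN mulmxA mxE mulrN.
Qed.

(** [x^T L x] dominates a positive multiple of [|x|^2] by [qform_le_trace]
    applied to the identity matrix. *)
Lemma gradient_flow_sqnorm_cvg0 (F : realType) (n : nat) (L : 'M[F]_n) (t0 : F)
    (x : F -> 'cV[F]_n) :
  posdefmx L -> {within `[t0, +oo[, continuous x} ->
  (forall t, t0 < t -> is_derive t 1 x (- (L *m x t))) ->
  qform 1%:M (x t) @[t --> +oo] --> (0 : F).
Proof.
move=> pL cx dx.
(* The absolute value and [+ 1] make [c] positive in dimension 0 too. *)
pose c := `|\tr (invmx L *m 1%:M)| + 1.
have c0 : 0 < c by rewrite ltr_wpDl.
apply: (differential_decay_cvg0 (a := 2 / c) _ _ _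
  (fun t tt => is_derive_flow_sqnorm (dx t tt))).
- by rewrite divr_gt0.
- exact: within_continuous_qform.
- by move=> t _; have [_] := posdefmx_semidef (posdefmx1 F n); apply.
- move=> t _; rewrite mulNr lerN2 mulrAC ler_pdivrMr// -mulrA ler_pM2l//.
  apply: le_trans (qform_le_trace (x t) pL (posdefmx1 F n)) _.
  rewrite mulrC ler_wpM2l//; first by have [_] := posdefmx_semidef pL; apply.
  by rewrite /c (le_trans (ler_norm _))// lerDl.
Qed.

Lemma gradient_flow_cvg0 (F : realType) (n : nat) (L : 'M[F]_n) (t0 : F)
    (x : F -> 'cV[F]_n) :
  posdefmx L -> {within `[t0, +oo[, continuous x} ->
  (forall t, t0 < t -> is_derive t 1 x (- (L *m x t))) ->
  x t @[t --> +oo] --> (0 : 'cV[F]_n).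
Proof.
by move=> pL cx dx; apply: cvg_sqnorm0; exact: gradient_flow_sqnorm_cvg0 pL cx dx.
Qed.

(** [- |x|^2] is a primitive of [2 x^T L x] along the flow and vanishes at
    infinity. *)
Lemma gradient_flow_energy (F : realType) (n : nat) (L : 'M[F]_n) (t0 : F)
    (x : F -> 'cV[F]_n) :
  posdefmx L -> {within `[t0, +oo[, continuous x} ->
  (forall t, t0 < t -> is_derive t 1 x (- (L *m x t))) ->
  (\int[lebesgue_measure]_(t in `[t0, +oo[) (qform (2 *: L) (x t))%:E
   = (qform 1%:M (x t0))%:E)%E.
Proof.
move=> pL cx dx.
have L0 v : 0 <= qform L v by have [_] := posdefmx_semidef pL; apply.
have dV t (tt : t0 < t) := is_derive_flow_sqnorm (dx t tt).
have cV := within_continuous_qform (M := 1%:M) cx.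
rewrite (@ge0_continuous_FTC2y _ (fun t => qform (2 *: L) (x t))
  (fun t => - qform 1%:M (x t)) t0 0).
- by rewrite EFinN oppeK add0e.
- by move=> t _; rewrite qformZ mulr_ge0.
- exact: within_continuous_qform.
- by rewrite -oppr0; apply: cvgN; exact: gradient_flow_sqnorm_cvg0 pL cx dx.
- by move=> t /dV [? _]; exact: derivableN.
- by apply: cvgN; have /continuous_within_itvcyP[] := cV.
- move=> t; rewrite in_itv/= andbT => /dV [dVt dVE].
  by rewrite derive1E deriveN// dVE opprK qformZ.
Qed.

Lemma gradient_flow_cost_le (F : realType) (n : nat) (L : 'M[F]_n) (t0 : F)
    (x : F -> 'cV[F]_n)
    (M : 'M[F]_n) k :
  posdefmx L -> {within `[t0, +oo[, continuous x} ->
  (forall t, t0 < t -> is_derive t 1 x (- (L *m x t))) ->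
  (forall v, 0 <= qform M v) -> 0 <= k ->
  (forall v, qform M v <= k * qform L v) ->
  (\int[lebesgue_measure]_(t in `[t0, +oo[) (qform M (x t))%:E
   <= (k / 2 * qform 1%:M (x t0))%:E)%E.
Proof.
move=> pL cx dx M0 k0 ML.
have L0 v : 0 <= qform L v by have [_] := posdefmx_semidef pL; apply.
have mq N : measurable_fun `[t0, +oo[ (fun t => qform N (x t)).
  apply: subspace_continuous_measurable_fun => //.
  exact: within_continuous_qform.
rewrite EFinM -(gradient_flow_energy pL cx dx) -ge0_integralZl_EFin//; last 3 first.
- by move=> t _; rewrite lee_fin qformZ mulr_ge0.
- apply/measurable_EFinP; exact: mq.
- by rewrite divr_ge0.
apply: ge0_le_integral => //.
- by move=> t _; rewrite lee_fin.
- apply/measurable_EFinP; exact: mq.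
- apply: measurable_funeM; apply/measurable_EFinP; exact: mq.
- by move=> t _; rewrite -EFinM lee_fin qformZ mulrA divfK.
Qed.

(** * The guaranteed-cost theorem *)

Theorem theorem3 (F : realType) (n m : nat)
    (A : 'M[F]_n) (B : 'M[F]_(n, m)) (Q : 'M[F]_n) (R : 'M[F]_m)
    (hQ : possemidefmx Q) (hR : posdefmx R)
    (X W Y Pl : 'M[F]_n)
    (hX : posdefmx X) (hW : posdefmx W)
    (hXY : negdefmx (X *m A^T + A *m X - Y^T *m B *m invmx R *m B^T
                     - B *m invmx R *m B^T *m Y))
    (hLMI : posdefmx
       (block3_mx
          (A^T *m Pl + Pl^T *m A - Q + W) (1%:M + Y^T *m A)^T (Pl^T *m B)
          (1%:M + Y^T *m A)               X                   0
          (Pl^T *m B)^T                   0                   R)) :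
  let P := Y *m invmx X in
  let Acl := A - B *m invmx R *m B^T *m P in
  hurwitz Acl /\
  (Acl^T = Acl ->
   forall Phat : 'M[F]_n,
   Acl *m Phat + Phat^T *m Acl + W = 0 ->
   forall x0 : 'cV[F]_n, x0 != 0 ->
   let gammabar := \tr (P - Pl + Phat) * (x0^T *m x0) 0 0 in
   0 < gammabar /\
   forall (t0 : F) (x : F -> 'cV[F]_n) (u : F -> 'cV[F]_m),
   (forall t : F, t0 <= t -> u t = - (invmx R *m B^T *m P *m x t)) ->
   lti_solution A B u t0 x0 x ->
   x t @[t --> +oo] --> (0 : 'cV[F]_n) /\
   (quadratic_cost Q R t0 x u < gammabar%:E)%E).
Proof.
move=> P Acl; have sX := hX.1.
have hK : hurwitz Acl.
  apply: (lyapunov_hurwitz hX); have sI := (posdefmx_inv hX).1.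
  have sRI := (posdefmx_inv hR).1.
  have PX : P *m X = Y by rewrite /P mulmxKV ?posdefmx_unit.
  have XPT : X *m P^T = Y^T by rewrite -[Y in RHS]PX [RHS]trmx_mul sX.
  suff -> : Acl *m X + X *m Acl^T = X *m A^T + A *m X - Y^T *m B *m invmx R *m B^T
                     - B *m invmx R *m B^T *m Y by [].
  have AT : Acl^T = A^T - P^T *m (B *m invmx R *m B^T).
    by rewrite [LHS]linearB /= [(_ *m P)^T]trmx_mul [(_ *m B^T)^T]trmx_mul
      [(B *m _)^T]trmx_mul trmxK sRI !mulmxA.
  rewrite AT /Acl mulmxBl mulmxBr -[_ *m P *m X]mulmxA PX !mulmxA XPT.
  by apply/matrixP => i j; rewrite !mxE; ring.
split=> // sK Phat hPhat x0 x0n0 gammabar.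
pose U := invmx R *m B^T *m P.
have KE : Acl = A - B *m U by rewrite /Acl /U !mulmxA.
have pL := hurwitz_symmetric_posdef sK hK.
set L := - Acl in pL.
pose D := Pl - P; pose G := P - Pl + Phat.
have pD := lmi_certificate hX hR hLMI; rewrite -/P -/U -KE -/D sK in pD.
set M := Q + _ in pD; set E := _ - M in pD.
have M0 v : 0 <= qform M v.
  by rewrite qformD qform_congr addr_ge0 ?hQ.2// (posdefmx_semidef hR).2.
have sM : M^T = M.
  by rewrite [LHS]linearD /= hQ.1 (trmx_mul (U^T *m R)) (trmx_mul U^T) trmxK hR.1 mulmxA.
have pN : posdefmx (E + M).
  split; first by rewrite linearD /= pD.1 sM.
  by move=> v v0; rewrite qformD ltr_wpDr// pD.2.
have NE : L *m G + G^T *m L = E + M.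
  rewrite /E subrK.
  have -> : G = Phat - D by rewrite /G /D opprB addrC.
  rewrite /L; clear -hPhat; clearbody Acl D.
  have -> : (Phat - D)^T = Phat^T - D^T by rewrite linearB.
  rewrite !mulmxBr !mulmxBl !mulmxN !mulNmx.
  have -> : W = - (Acl *m Phat + Phat^T *m Acl).
    by apply/eqP; rewrite -addr_eq0 addrC hPhat.
  by apply/matrixP => i j; rewrite !mxE; ring.
have := trace_lyapunov (posdefmx_unit pL) NE.
set c := \tr (invmx L *m (E + M)) => cE.
(* [e] is chosen so that [e L <= E = N - M]; it measures the strictness of the
   final inequality. *)
pose e := (1 + `|\tr (invmx E *m L)|)^-1.
have e0 : 0 < e by rewrite invr_gt0 ltr_pwDl.
have Mc v : qform M v <= (c - e) * qform L v.
  have := qform_le_trace v pL pN; rewrite -/c qformD mulrBl.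
  suff : e * qform L v <= qform E v by lra.
  have L0 : 0 <= qform L v by rewrite (posdefmx_semidef pL).2.
  have E0 : 0 <= qform E v by rewrite (posdefmx_semidef pD).2.
  rewrite mulrC ler_pdivrMr ?ltr_pwDl// mulrC.
  apply: le_trans (qform_le_trace v pD pL) _; rewrite ler_wpM2r//.
  by rewrite (le_trans (ler_norm _))// lerDr.
have Lx0 := pL.2 _ x0n0.
have ce0 : 0 <= c - e.
  by have := le_trans (M0 x0) (Mc x0); rewrite pmulr_lge0.
have gE : gammabar = c / 2 * qform 1%:M x0.
  by rewrite /gammabar -/G cE /qform mulmx1 [2 * _]mulrC mulfK.
have sq0 : 0 < qform 1%:M x0 by apply: (posdefmx1 F n).2.
split; first by rewrite gE mulr_gt0// divr_gt0//; lra.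
move=> t0 x u uE [xt0 cx dx].
have dx' t : t0 < t -> is_derive t 1 x (- (L *m x t)).
  move=> tt; apply: (is_derive_eq (dx _ tt)).
  by rewrite uE ?ltW// mulmxN -/U /L mulNmx opprK KE mulmxBl mulmxA.
split; first exact: gradient_flow_cvg0 pL cx dx'.
have -> : quadratic_cost Q R t0 x u
    = (\int[lebesgue_measure]_(t in `[t0, +oo[) (qform M (x t))%:E)%E.
  apply: eq_integral => t; rewrite inE/= in_itv/= andbT => tt.
  rewrite qformD qform_congr uE// -/U; by rewrite qform_oppv.
apply: le_lt_trans (gradient_flow_cost_le pL cx dx' M0 ce0 Mc) _.
by rewrite lte_fin gE xt0 ltr_pM2r// ltr_pM2r ?invr_gt0//; lra.
Qed.
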